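(* Suppose that the following hold: (a) there exists an $L\ge0$ such that, for $i=1,\ldots,N$, $\|\nabla_i f(X)-\nabla_i f(X')\|\le L\|X-X'\|$ for all $X,X'\in\mathcal{F}$; (b) there exists an $\underline{f}\in\mathbb{R}$ such that the optimal value of the problem of minimizing $f$ over $\mathcal{F}$ is lower bounded by $\underline{f}$ for any $\{m_i\}_{i=1}^N,\{n_i\}_{i=1}^N\subseteq\mathbb{N}$; (c) there exists a $q>0$ such that, for any $\{m_i\}_{i=1}^N,\{n_i\}_{i=1}^N\subseteq\mathbb{N}$, $\mathbf{a}_i^\top\mathbf{1}_{m_i}=\mathbf{b}_i^\top\mathbf{1}_{n_i}=1$, $\max_j a_{i,j}\le q\cdot\min_j a_{i,j}$, and $\max_k b_{i,k}\le q\cdot\min_k b_{i,k}$; (d) there exists a $\theta\ge0$ such that, for any $\{m_i\}_{i=1}^N,\{n_i\}_{i=1}^N\subseteq\mathbb{N}$, the block Lipschitz constant satisfies $L=\mathcal{O}\big(\sum_{i=1}^N(m_i+n_i)^\theta\big)$. Let $\{X^{(t)}\}$ be the iterate sequence generated by the ERALM method when $$t_{\max}\ge\max\left\{\Omega\Big(\sum_{i=1}^N(m_i+n_i)^\eta\Big),\ \frac{f(X^{(0)})-\underline{f}}{2\bar d^2LN(2\sqrt{N}+1)}\right\},\qquad f(X^{(0)})\le M,$$ $$\alpha_1^{(t)}=\cdots=\alpha_N^{(t)}\equiv\alpha:=\frac{1}{\bar d}\sqrt{\frac{f(X^{(0)})-\underline{f}}{2LN(2\sqrt{N}+1)t_{\max}}},\qquad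 \lambda_1^{(t)}=\cdots=\lambda_N^{(t)}\equiv\lambda=o\left(\frac{1}{\sum_{i=1}^N\log m_in_i}\right)$$ for $0\le t\le t_{\max}$ and the entropy-regularized subproblems are exactly solved, where $\eta\,(>\theta)$ and $M$ are constants independent of $\{m_i\}_{i=1}^N$ and $\{n_i\}_{i=1}^N$. Then $$\frac{1}{t_{\max}}\sum_{t=0}^{t_{\max}-1}R(X^{(t)})\to0\quad\text{as}\quad\sum_{i=1}^N(m_i+n_i)\to+\infty.$$
   Context: Let $N\ge1$. One considers problems of minimizing $f$ over $\mathcal{F}$ for varying sizes $\{m_i\}_{i=1}^N,\{n_i\}_{i=1}^N$ (with $f$, $\mathbf{a}_i$, $\mathbf{b}_i$ depending on the sizes); the asymptotic notation $\mathcal{O},\Omega,o$ refers to $\sum_{i=1}^N(m_i+n_i)\to+\infty$. For $i=1,\ldots,N$, $\mathbf{a}_i=(a_{i,j})\in\mathbb{R}_+^{m_i}$ and $\mathbf{b}_i=(b_{i,k})\in\mathbb{R}_+^{n_i}$. With $\mathbf{1}_n$ the all-ones vector in $\mathbb{R}^n$, the transport polytope is $\mathcal{U}(\mathbf{a}_i,\mathbf{b}_i):=\{T\in\mathbb{R}_+^{m_i\times n_i}\mid T\mathbf{1}_{n_i}=\mathbf{a}_i,\ T^\top\mathbf{1}_{m_i}=\mathbf{b}_i\}$, and $\mathcal{F}:=\prod_{i=1}^N\mathcal{U}(\mathbf{a}_i,\mathbf{b}_i)$. The objective is a possibly nonconvex function $f:\prod_{i=1}^N\mathbb{R}^{m_i\times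 n_i}\to\mathbb{R}$. A point is written $X=(X_1,\ldots,X_N)$; $\nabla_i f$ is the gradient with respect to block $X_i$; $\langle\cdot,\cdot\rangle$ and $\|\cdot\|$ are the standard (Euclidean/Frobenius) inner product and norm. $d_i:=\min\{\sqrt{m_i}\|\mathbf{a}_i\|_\infty,\sqrt{n_i}\|\mathbf{b}_i\|_\infty\}$ ($i=1,\ldots,N$) and $\bar d:=\max_{i=1,\ldots,N}d_i$. Negative entropy: $h(T):=\sum_{j,k}t_{jk}(\log t_{jk}-1)$ for an entrywise nonnegative matrix $T=(t_{jk})$ (with $0\log0=0$). Residual functions: $R_i(X):=\max_{T\in\mathcal{U}(\mathbf{a}_i,\mathbf{b}_i)}\langle\nabla_i f(X),X_i-T\rangle$ for $i=1,\ldots,N$, and $R:=\sum_{i=1}^N R_i$. ERALM (entropy regularized alternating linearized minimization) method: the input is $X_i^{(0)}\in\mathbb{R}^{m_i\times n_i}$ ($i=1,\ldots,N$) and $t_{\max}\in\mathbb{N}$. For $t=0,1,\ldots,t_{\max}-1$ and, within each $t$, for $i=1,\ldots,N$ in order, a regularization parameter $\lambda_i^{(t)}>0$ and a step size $\alpha_i^{(t)}\in(0,1]$ are selected; set $C_i^{(t)}:=\nabla_i f(X_1^{(t+1)},\ldots,X_{i-1}^{(t+1)},X_i^{(t)},\ldots,X_N^{(t)})$; let $\tilde X_i^{(t+1)}$ be the solution of the entropy-regularized subproblem $$\min_{X_i}\ \langle C_i^{(t)},X_i-X_i^{(t)}\rangle+\lambda_i^{(t)}h(X_i)\quad\text{s.t.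 } X_i\mathbf{1}_{n_i}=\mathbf{a}_i,\ X_i^\top\mathbf{1}_{m_i}=\mathbf{b}_i$$ (nonnegativity of $X_i$ is implicit in the domain of $h$); and set $X_i^{(t+1)}:=(1-\alpha_i^{(t)})X_i^{(t)}+\alpha_i^{(t)}\tilde X_i^{(t+1)}$.
   Formalization: The initial point X^(0) is assumed to lie in F; for an arbitrary X^(0) the claim fails, since f is controlled only on F and R(X^(0))/t_max can be arbitrarily large. *)

(* Defs.v *)
From HB Require Import structures.
From mathcomp Require Import all_boot all_order all_algebra.
From mathcomp Require Import all_classical all_reals all_analysis.

Set Implicit Arguments.
Unset Strict Implicit.
Unset Printing Implicit Defensive.

Import Order.TTheory GRing.Theory Num.Theory.
Import numFieldNormedType.Exports.

Local Open Scope classical_set_scope.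
Local Open Scope ring_scope.

(* The sizes (m_i), (n_i) of the blocks.  They are positive: no vector of
   size 0 has entries summing to 1. *)
Record sizes (N : nat) := Sizes {
  nrow : 'I_N -> nat;
  ncol : 'I_N -> nat;
  nrow_gt0 : forall i, (0 < nrow i)%N;
  ncol_gt0 : forall i, (0 < ncol i)%N }.

Definition total_size N (s : sizes N) : nat :=
  (\sum_(i < N) (nrow s i + ncol s i))%N.

(* The limit regime \sum_i (m_i + n_i) -> +oo. *)
Definition sizes_oo N : set_system (sizes N) :=
  filter_from [set: nat] (fun K => [set s | (K <= total_size s)%N]).

Arguments sizes_oo N : clear implicits.

Global Instance sizes_oo_filter N : Filter (sizes_oo N).
Proof.
apply: filter_from_filter; first by exists 0%N.
move=> K L _ _; exists (maxn K L) => // s /=.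
by rewrite geq_max => /andP[].
Qed.

Canonical sizes_oo_filter_on N := FilterType (sizes_oo N) (sizes_oo_filter N).

Section Matrices.
Context {R : realType} {m n : nat}.

Definition inner (A B : 'M[R]_(m, n)) : R := \sum_j \sum_k A j k * B j k.

(* The library norm [`|A|] on matrices is the sup norm, hence this one. *)
Definition frobenius (A : 'M[R]_(m, n)) : R := Num.sqrt (inner A A).

Definition transport_polytope (a : 'cV[R]_m) (b : 'cV[R]_n) : set 'M[R]_(m, n) :=
  [set T : 'M[R]_(m, n) |
    [/\ forall j k, 0 <= T j k,
        T *m const_mx 1 = a & T^T *m const_mx 1 = b]].

(* 0 log 0 = 0 holds since [ln 0 = 0]. *)
Definition neg_entropy (T : 'M[R]_(m, n)) : R :=
  \sum_j \sum_k T j k * (ln (T j k) - 1).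

(* vec_max and vec_min are the sup and inf of finite sets, nonempty when
   0 < m. *)
Definition vec_max (a : 'cV[R]_m) : R := sup (range (fun j => a j ord0)).
Definition vec_min (a : 'cV[R]_m) : R := inf (range (fun j => a j ord0)).

Definition entropic_solution (a : 'cV[R]_m) (b : 'cV[R]_n) (lam : R)
    (C X0 X : 'M[R]_(m, n)) : Prop :=
  let obj T := inner C (T - X0) + lam * neg_entropy T in
  transport_polytope a b X /\
  forall T, transport_polytope a b T -> obj X <= obj T.

End Matrices.

Definition blocks (R : realType) (N : nat) (s : sizes N) : Type :=
  forall i : 'I_N, 'M[R]_(nrow s i, ncol s i).

Section Problem.
Context {R : realType} {N : nat} {s : sizes N}.

Definition blocks_norm (X : blocks R s) : R :=
  Num.sqrt (\sum_i inner (X i) (X i)).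

Section Objective.
Variable f : blocks R s -> R.

Definition block_fun (X : blocks R s) (i : 'I_N)
    (Y : 'M[R]_(nrow s i, ncol s i)) : R :=
  f (dfwith X i Y).

Definition block_differentiable (X : blocks R s) (i : 'I_N) : Prop :=
  differentiable (block_fun X (i := i)) (X i).

(* The Frobenius gradient; meaningful when [block_differentiable X i]. *)
Definition block_grad (i : 'I_N) (X : blocks R s) : 'M[R]_(nrow s i, ncol s i) :=
  \matrix_(j, k) 'D_(delta_mx j k) (block_fun X (i := i)) (X i).

End Objective.

Variables (a : forall i : 'I_N, 'cV[R]_(nrow s i))
          (b : forall i : 'I_N, 'cV[R]_(ncol s i)).

Definition feasible : set (blocks R s) :=
  [set X | forall i, transport_polytope (a i) (b i) (X i)].

Definition optimal_value (f : blocks R s -> R) : \bar R :=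
  ereal_inf [set (f X)%:E | X in feasible].

(* [`|a i|] is the sup norm. *)
Definition dim_const (i : 'I_N) : R :=
  Num.min (Num.sqrt (nrow s i)%:R * `|a i|) (Num.sqrt (ncol s i)%:R * `|b i|).

Definition dbar : R := \big[Num.max/0]_(i < N) dim_const i.

Variable f : blocks R s -> R.

Definition block_residual (i : 'I_N) (X : blocks R s) : R :=
  sup [set inner (block_grad f i X) (X i - T) |
        T in transport_polytope (a i) (b i)].

Definition residual (X : blocks R s) : R := \sum_(i < N) block_residual i X.

(* The point reached just before block i is updated at iteration t. *)
Definition partial_update (X : nat -> blocks R s) (t : nat) (i : 'I_N) :
    blocks R s :=
  fun j => if (j < i)%N then X t.+1 j else X t j.

(* [X] restricted to [0 .. tmax] is an iterate sequence of the method with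
   regularization parameters [lam t i] and step sizes [alpha t i]. *)
Definition eralm (tmax : nat) (lam alpha : nat -> 'I_N -> R)
    (X : nat -> blocks R s) : Prop :=
  forall t (i : 'I_N), (t < tmax)%N ->
    [/\ 0 < lam t i,
        0 < alpha t i <= 1 &
        exists2 Xt : 'M[R]_(nrow s i, ncol s i),
          entropic_solution (a i) (b i) (lam t i)
            (block_grad f i (partial_update X t i)) (X t i) Xt &
          X t.+1 i = (1 - alpha t i) *: X t i + alpha t i *: Xt].

End Problem.

(* Main.v *)
Require Import Defs.
From mathcomp Require Import all_boot all_order all_algebra.
From mathcomp Require Import all_classical all_reals all_analysis.
From mathcomp Require Import ring lra.

Set Implicit Arguments.
Unset Strict Implicit.
Unset Printing Implicit Defensive.

Import Order.TTheory GRing.Theory Num.Theory.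
Import numFieldNormedType.Exports.

Local Open Scope classical_set_scope.
Local Open Scope ring_scope.

(* Write d for dbar, K for L N (2 sqrt N + 1) and Delta for f(X^0) - f_low.
   Transport polytopes have diameter at most sqrt 2 d and the entropy ranges over
   an interval of length log (m_i n_i) on them.  Comparing the subproblem
   solution with an arbitrary T and using the descent lemma, the update of block
   i decreases f by at least
     alpha (R_i(X^t) - lambda log (m_i n_i)) - L alpha^2 d^2 (2 sqrt N + 1),
   where 2 sqrt N accounts for the gradient being taken at the partially updated
   point.  Summing over blocks and iterations, the mean residual is at most
     Delta / (alpha tmax) + lambda sum_i log (m_i n_i) + K alpha d^2
   and for the chosen alpha the outer terms add up to
   3 d sqrt (Delta K / (2 tmax)).  The ratio condition bounds d by q, and
   L / tmax -> 0 because theta < eta. *)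

(** * Frobenius inner product and the Cauchy-Schwarz inequality *)

Section InnerProduct.
Context {R : realType} {m n : nat}.
Implicit Types A B C : 'M[R]_(m, n).

Lemma innerC A B : inner A B = inner B A.
Proof. by apply: eq_bigr => j _; apply: eq_bigr => k _; rewrite mulrC. Qed.

Lemma innerDr A B C : inner A (B + C) = inner A B + inner A C.
Proof.
rewrite /inner -big_split; apply: eq_bigr => j _ /=.
by rewrite -big_split; apply: eq_bigr => k _; rewrite !mxE mulrDr.
Qed.

Lemma innerZr c A B : inner A (c *: B) = c * inner A B.
Proof.
rewrite /inner mulr_sumr; apply: eq_bigr => j _.
by rewrite mulr_sumr; apply: eq_bigr => k _; rewrite !mxE mulrCA.
Qed.

Lemma inner0r A : inner A 0 = 0.
Proof. by rewrite -(scale0r (0 : 'M[R]_(m, n))) innerZr mul0r. Qed.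

Lemma innerBr A B C : inner A (B - C) = inner A B - inner A C.
Proof. by rewrite innerDr -scaleN1r innerZr mulN1r. Qed.

Lemma innerZl c A B : inner (c *: A) B = c * inner A B.
Proof. by rewrite innerC innerZr innerC. Qed.

Lemma innerBl A B C : inner (A - B) C = inner A C - inner B C.
Proof. by rewrite innerC innerBr !(innerC C). Qed.

Lemma inner_ge0 A B : (forall j k, 0 <= A j k) -> (forall j k, 0 <= B j k) ->
  0 <= inner A B.
Proof.
by move=> A0 B0; apply: sumr_ge0 => j _; apply: sumr_ge0 => k _; rewrite mulr_ge0.
Qed.

Lemma inner_self_ge0 A : 0 <= inner A A.
Proof.
by apply: sumr_ge0 => j _; apply: sumr_ge0 => k _; rewrite -expr2 sqr_ge0.
Qed.

Lemma inner_self_eq0 A : inner A A = 0 -> A = 0.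
Proof.
have sq_ge0 j k : 0 <= A j k * A j k by rewrite -expr2 sqr_ge0.
move=> A0; apply/matrixP => j k; rewrite mxE.
have row0 : \sum_k A j k * A j k = 0.
  by apply: (psumr_eq0P _ A0) => // i _; apply: sumr_ge0.
have /eqP : A j k * A j k = 0 by apply: (psumr_eq0P _ row0).
by rewrite mulf_eq0 orbb => /eqP.
Qed.

Lemma inner_le_frobenius A B : inner A B <= frobenius A * frobenius B.
Proof.
have AA := inner_self_ge0 A; have BB := inner_self_ge0 B.
apply: (le_trans (ler_norm _)).
rewrite /frobenius -sqrtrM// -sqrtr_sqr ler_wsqrtr// expr2.
have [B0|B_neq0] := eqVneq (inner B B) 0.
  have -> : B = 0 by exact: inner_self_eq0.
  by rewrite !inner0r mul0r mulr0.
have BB_gt0 : 0 < inner B B by rewrite lt_def B_neq0.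
(* This square equals [inner B B] times the Cauchy-Schwarz defect, so the positive factor can be
   cancelled. *)
have := inner_self_ge0 (inner B B *: A - inner A B *: B).
rewrite innerBl !innerBr !innerZl !innerZr (innerC B A).
have -> (x y z : R) : x * (x * y) - x * (z * z) - (z * (x * z) - z * (z * x))
  = x * (y * x - z * z) by ring.
by rewrite pmulr_rge0// subr_ge0.
Qed.

End InnerProduct.

(** * Transport polytopes: size, convexity, range of the entropy *)

Section TransportPolytope.
Context {R : realType}.

Lemma row_sum m n (T : 'M[R]_(m, n)) j : (T *m (const_mx 1 : 'cV_n)) j ord0 = \sum_k T j k.
Proof. by rewrite mxE; apply: eq_bigr => k _; rewrite mxE mulr1. Qed.

Lemma transport_polytope_tr m n (a : 'cV[R]_m) (b : 'cV[R]_n) T :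
  transport_polytope a b T -> transport_polytope b a T^T.
Proof. by move=> [T0 Ta Tb]; split => [j k||]; rewrite ?mxE// trmxK. Qed.

Lemma inner_tr m n (A B : 'M[R]_(m, n)) : inner A^T B^T = inner A B.
Proof.
rewrite /inner exchange_big; apply: eq_bigr => j _.
by apply: eq_bigr => k _; rewrite !mxE.
Qed.

Lemma entry_le_norm m (a : 'cV[R]_m) j : `|a j ord0| <= `|a|.
Proof.
rewrite [leRHS]mx_normrE.
exact: (le_bigmax _ (fun ij : 'I_m * 'I_1 => `|a ij.1 ij.2|) (j, ord0)).
Qed.

(** Entries of a row are nonnegative, so each is at most the row sum [a j]; hence the squares in row
    [j] add up to at most [a j ^+ 2]. *)
Lemma inner_self_le_row m n (a : 'cV[R]_m) (b : 'cV[R]_n) T :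
  transport_polytope a b T -> inner T T <= (Num.sqrt m%:R * `|a|) ^+ 2.
Proof.
move=> [T0 Ta _]; rewrite exprMn sqr_sqrtr ?ler0n//.
have -> : m%:R * `|a| ^+ 2 = \sum_(j < m) `|a| ^+ 2.
  by rewrite sumr_const card_ord mulr_natl.
apply: ler_sum => j _.
have aj : \sum_k T j k = a j ord0 by rewrite -row_sum Ta.
have aj0 : 0 <= a j ord0 by rewrite -aj sumr_ge0.
apply: (@le_trans _ _ (a j ord0 ^+ 2)); last first.
  by rewrite lerXn2r ?nnegrE// -[leLHS]ger0_norm// entry_le_norm.
rewrite expr2 -{1}aj mulr_suml; apply: ler_sum => k _.
by rewrite ler_wpM2l// -aj (bigD1 k)//= lerDl sumr_ge0.
Qed.

Lemma inner_self_le m n (a : 'cV[R]_m) (b : 'cV[R]_n) T :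
  transport_polytope a b T ->
  inner T T <= Num.min (Num.sqrt m%:R * `|a|) (Num.sqrt n%:R * `|b|) ^+ 2.
Proof.
move=> T_ab; rewrite minEle; case: ifP => _; first exact: inner_self_le_row T_ab.
by rewrite -inner_tr; apply: inner_self_le_row; apply: transport_polytope_tr T_ab.
Qed.

(* Nonnegativity of [inner T T'] gives the diameter [sqrt 2 * d] instead of [2 * d]. *)
Lemma transport_polytope_diam m n (a : 'cV[R]_m) (b : 'cV[R]_n) d T T' :
  Num.min (Num.sqrt m%:R * `|a|) (Num.sqrt n%:R * `|b|) <= d ->
  transport_polytope a b T -> transport_polytope a b T' ->
  inner (T - T') (T - T') <= 2 * d ^+ 2.
Proof.
move=> ab_le T_ab T'_ab.
have min_ge0 : 0 <= Num.min (Num.sqrt m%:R * `|a|) (Num.sqrt n%:R * `|b|).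
  by rewrite le_min !mulr_ge0 ?sqrtr_ge0.
have min_sq : Num.min (Num.sqrt m%:R * `|a|) (Num.sqrt n%:R * `|b|) ^+ 2 <= d ^+ 2.
  by rewrite lerXn2r ?nnegrE// (le_trans min_ge0).
have T2 := le_trans (inner_self_le T_ab) min_sq.
have T'2 := le_trans (inner_self_le T'_ab) min_sq.
have TT' : 0 <= inner T T' by case: T_ab T'_ab => [? _ _] [? _ _]; exact: inner_ge0.
rewrite innerBl !innerBr (innerC T' T); lra.
Qed.

Lemma transport_polytope_convex m n (a : 'cV[R]_m) (b : 'cV[R]_n) u T T' :
  0 <= u <= 1 -> transport_polytope a b T -> transport_polytope a b T' ->
  transport_polytope a b ((1 - u) *: T + u *: T').
Proof.
move=> /andP[u0 u1] [T0 Ta Tb] [T'0 T'a T'b]; split => [j k||].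
- by rewrite !mxE addr_ge0// mulr_ge0// subr_ge0.
- by rewrite mulmxDl -!scalemxAl Ta T'a -scalerDl subrK scale1r.
- by rewrite linearD !linearZ mulmxDl -!scalemxAl Tb T'b -scalerDl subrK scale1r.
Qed.

Lemma transport_polytope_mass m n (a : 'cV[R]_m) (b : 'cV[R]_n) T :
  transport_polytope a b T -> \sum_j \sum_k T j k = \sum_j a j ord0.
Proof. by move=> [_ <- _]; apply: eq_bigr => j _; rewrite row_sum. Qed.

(** Unit mass keeps every entry in [0, 1], where [t * ln t] is nonpositive. *)
Lemma neg_entropy_le m n (T : 'M[R]_(m, n)) : (forall j k, 0 <= T j k) ->
  \sum_j \sum_k T j k = 1 -> neg_entropy T <= - 1.
Proof.
move=> T0 T1; rewrite -T1 -sumrN; apply: ler_sum => j _.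
rewrite -sumrN; apply: ler_sum => k _.
have Tjk1 : T j k <= 1.
  rewrite -T1 (bigD1 j)//= (bigD1 k)//= -addrA lerDl addr_ge0//.
    by rewrite sumr_ge0.
  by rewrite sumr_ge0// => ? _; rewrite sumr_ge0.
by rewrite mulrBr mulr1 gerDr mulr_ge0_le0// ln_le0.
Qed.

(* Gibbs' inequality against the uniform distribution. *)
Lemma neg_entropy_ge m n (T : 'M[R]_(m, n)) : (0 < m)%N -> (0 < n)%N ->
  (forall j k, 0 <= T j k) -> \sum_j \sum_k T j k = 1 ->
  - 1 - ln (m * n)%:R <= neg_entropy T.
Proof.
move=> m0 n0 T0 T1; set c : R := (m * n)%:R.
have c0 : 0 < c by rewrite ltr0n muln_gt0 m0.
(* This is [ln u <= u - 1] at [u = (t * c)^-1], multiplied by [t]; the case [t = 0] is separate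
   because [u] degenerates there. *)
have gibbs : forall t, 0 <= t -> - c^-1 - t * ln c <= t * (ln t - 1).
  move: c c0 => c c0 t; rewrite le_eqVlt => /predU1P[<-|t0].
    by rewrite !mul0r subr0 oppr_le0 invr_ge0 ltW.
  have tc0 : 0 < t * c by rewrite mulr_gt0.
  have : ln (1 + ((t * c)^-1 - 1)) <= (t * c)^-1 - 1.
    by apply: le_ln1Dx; rewrite ltrBDr addNr invr_gt0.
  rewrite addrC subrK lnV ?posrE// lnM ?posrE// => le_ln.
  have := ler_wpM2l (ltW t0) le_ln.
  have -> : t * ((t * c)^-1 - 1) = c^-1 - t.
    by field; rewrite (gt_eqF c0) (gt_eqF t0).
  lra.
(* There are [c] entries, so the terms [- c^-1] add up to [- 1], and unit mass collects [ln c]. *)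
have -> : - 1 - ln c = \sum_(j < m) \sum_(k < n) (- c^-1 - T j k * ln c).
  under eq_bigr do rewrite big_split /= sumr_const card_ord sumrN -mulr_suml.
  rewrite big_split /= sumr_const card_ord sumrN -mulr_suml T1 mul1r.
  by rewrite -mulrnA -mulr_natr mulnC -/c mulNr mulVf ?gt_eqF.
by apply: ler_sum => j _; apply: ler_sum => k _; exact: gibbs.
Qed.

End TransportPolytope.

(** * Gradients of matrix functions and the descent lemma *)

Section Descent.
Context {R : realType} {m n : nat}.
Implicit Types (g : 'M[R]_(m, n) -> R) (A V : 'M[R]_(m, n)).

Definition mx_grad g A : 'M[R]_(m, n) := \matrix_(j, k) 'D_(delta_mx j k) g A.

Lemma derive_mx_grad g A V : differentiable g A -> 'D_V g A = inner (mx_grad g A) V.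
Proof.
move=> dg; rewrite deriveE// {1}[V]matrix_sum_delta linear_sum; apply: eq_bigr => j _.
rewrite linear_sum; apply: eq_bigr => k _.
by rewrite linearZ /= -deriveE// mxE mulrC.
Qed.

Lemma is_derive_line g A V t : differentiable g (A + t *: V) ->
  is_derive t 1 (fun u : R => g (A + u *: V)) (inner (mx_grad g (A + t *: V)) V).
Proof.
move=> dg; rewrite -derive_mx_grad//.
(* The difference quotient of the restriction to the line is literally the one defining the
   derivative of [g] along [V]. *)
have lineE : (fun h : R => h^-1 *: (g (A + (h *: 1 + t) *: V) - g (A + t *: V))) =
    (fun h : R => h^-1 *: (g (h *: V + (A + t *: V)) - g (A + t *: V))).
  by apply/funext => h; rewrite addrCA -scalerDl [h *: 1]mulr1.
have := @diff_derivable _ _ _ g (A + t *: V) V dg.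
by split; rewrite /derivable /derive /= lineE.
Qed.

(** Both hypotheses are confined to the segment from [A] to [A + V], since smoothness is only
    assumed at feasible points. *)
Lemma descent g A V (c : R) :
  (forall t : R, 0 <= t <= 1 -> differentiable g (A + t *: V)) ->
  (forall t : R, 0 <= t <= 1 ->
    inner (mx_grad g (A + t *: V) - mx_grad g A) V <= c * t) ->
  g (A + V) <= g A + inner (mx_grad g A) V + c / 2.
Proof.
move=> dg lip; set l := inner (mx_grad g A) V.
(* [g] along the segment minus its linear and quadratic model: the Lipschitz hypothesis makes [p]
   nonincreasing, and [p 1 <= p 0] is the claim. *)
pose p := fun t : R => g (A + t *: V) - t * l - c / 2 * t ^+ 2.
have dp (t : R) : 0 <= t <= 1 ->
    is_derive t 1 p (inner (mx_grad g (A + t *: V) - mx_grad g A) V - c * t).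
  move=> t01; have dline := is_derive_line (dg t t01).
  have -> : p = (fun u : R => g (A + u *: V)) - l \*: id - (c / 2) \*: (id ^+ 2).
    by apply/funext => u; rewrite /p [u * l]mulrC.
  apply: is_derive_eq; rewrite innerBl -/l /GRing.scale /=; lra.
have p_cont : {within `[0, 1], continuous p}.
  apply: continuous_in_subspaceT => t; rewrite inE /= in_itv /= => t01.
  by apply: differentiable_continuous; apply/derivable1_diffP; apply: ex_derive; apply: dp.
have : p 1 <= p 0.
  apply: (ler0_derive1_le _ _ p_cont); rewrite ?in_itv /= ?lexx ?ler01//.
    by move=> t; rewrite in_itv /= => /andP[t0 t1]; apply: ex_derive; apply: dp; rewrite !ltW.
  move=> t; rewrite in_itv /= => /andP[t0 t1].
  have t01 : 0 <= t <= 1 by rewrite !ltW.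
  by rewrite derive1E (@derive_val _ _ _ _ _ _ _ (dp t t01)) subr_le0 lip.
by rewrite /p scale1r scale0r addr0; lra.
Qed.

End Descent.

(** Compare the objective at [X] and at [T]: the two entropies lie in an interval of length
    [ln (m * n)], so regularization costs at most [lam] times that length. *)
Lemma entropic_solution_le (R : realType) m n (a : 'cV[R]_m) (b : 'cV[R]_n) lam C X0 X T :
  (0 < m)%N -> (0 < n)%N -> \sum_j a j ord0 = 1 -> 0 <= lam ->
  entropic_solution a b lam C X0 X -> transport_polytope a b T ->
  inner C (X - X0) <= - inner C (X0 - T) + lam * ln (m * n)%:R.
Proof.
move=> m0 n0 a1 lam0 [X_ab X_min] T_ab; have := X_min T T_ab.
have hT : neg_entropy T <= - 1.
  by case: (T_ab) => T0 _ _; apply: neg_entropy_le; rewrite ?(transport_polytope_mass T_ab).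
have hX : - 1 - ln (m * n)%:R <= neg_entropy X.
  by case: (X_ab) => ? _ _; apply: neg_entropy_ge; rewrite ?(transport_polytope_mass X_ab).
have := ler_wpM2l lam0 hT; have := ler_wpM2l lam0 hX.
rewrite !innerBr; lra.
Qed.

(** * Updating a single block *)

Section Blocks.
Context {R : realType} {N : nat} {s : sizes N}.
Variables (f : blocks R s -> R) (L d : R).
Variables (a : forall i : 'I_N, 'cV[R]_(nrow s i)) (b : forall i : 'I_N, 'cV[R]_(ncol s i)).
Implicit Types (P X : blocks R s) (i : 'I_N).

Lemma blocks_ext X (Y : blocks R s) : (forall i, X i = Y i) -> X = Y.
Proof. exact: functional_extensionality_dep. Qed.

Lemma dfwith_same P i Y Z : dfwith (dfwith P i Y : blocks R s) i Z = dfwith P i Z :> blocks R s.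
Proof.
apply: blocks_ext => j; have [<-|ij] := eqVneq i j; first by rewrite !dfwithin.
by rewrite !dfwithout.
Qed.

Lemma dfwith_self P i : dfwith P i (P i) = P.
Proof.
apply: blocks_ext => j; have [<-|ij] := eqVneq i j; first by rewrite dfwithin.
by rewrite dfwithout.
Qed.

Lemma block_fun_dfwith P i Y : block_fun f (dfwith P i Y) (i := i) = block_fun f P (i := i).
Proof. by apply/funext => Z; rewrite /block_fun dfwith_same. Qed.

(** Turns block gradients at points that differ only in block [i] into gradients of one fixed
    function, the form [descent] expects. *)
Lemma block_grad_dfwith P i Y :
  block_grad f i (dfwith P i Y) = mx_grad (block_fun f P (i := i)) Y.
Proof. by rewrite -[in RHS](dfwithin P Y) -(block_fun_dfwith P Y). Qed.

Lemma feasible_dfwith P i Y : feasible a b P -> transport_polytope (a i) (b i) Y ->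
  feasible a b (dfwith P i Y).
Proof.
move=> P_ab Y_ab j; have [<-|ij] := eqVneq i j; first by rewrite dfwithin.
by rewrite dfwithout.
Qed.

Lemma blocks_norm_dfwith P i Y :
  blocks_norm (fun j => dfwith P i Y j - P j) = frobenius (Y - P i).
Proof.
rewrite /blocks_norm (bigD1 i)//= dfwithin big1 ?addr0// => j ji.
by rewrite dfwithout 1?eq_sym// subrr inner0r.
Qed.

Lemma dim_const_ge0 i : 0 <= dim_const a b i.
Proof. by rewrite le_min !mulr_ge0 ?sqrtr_ge0. Qed.

Lemma dim_const_le_dbar i : dim_const a b i <= dbar a b.
Proof. exact: le_bigmax. Qed.

Hypothesis L_ge0 : 0 <= L.
Hypothesis f_diff : forall X i, feasible a b X -> block_differentiable f X i.
Hypothesis grad_lipschitz : forall i X Y, feasible a b X -> feasible a b Y ->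
  frobenius (block_grad f i X - block_grad f i Y) <= L * blocks_norm (fun j => X j - Y j).
Hypothesis dim_le : forall i, dim_const a b i <= d.

Lemma polytope_diam i T T' :
  transport_polytope (a i) (b i) T -> transport_polytope (a i) (b i) T' ->
  frobenius (T - T') ^+ 2 <= 2 * d ^+ 2.
Proof.
move=> T_ab T'_ab; rewrite sqr_sqrtr ?inner_self_ge0//.
exact: transport_polytope_diam (dim_le i) _ _.
Qed.

(** The displacement [V] has squared norm at most [2 * alpha ^+ 2 * d ^+ 2]; the factor 2 cancels
    the 1/2 of the descent lemma. *)
Lemma block_descent P i Y (alpha : R) : feasible a b P ->
  transport_polytope (a i) (b i) Y -> 0 <= alpha <= 1 ->
  f (dfwith P i ((1 - alpha) *: P i + alpha *: Y)) <=
    f P + alpha * inner (block_grad f i P) (Y - P i) + L * alpha ^+ 2 * d ^+ 2.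
Proof.
move=> P_ab Y_ab alpha01; set V := alpha *: (Y - P i).
have seg t : P i + t *: V = (1 - t * alpha) *: P i + (t * alpha) *: Y.
  by rewrite /V scalerA scalerBr scalerBl scale1r addrAC addrA addrAC.
have seg_ab t : 0 <= t <= 1 -> transport_polytope (a i) (b i) (P i + t *: V).
  move=> t01; rewrite seg; apply: transport_polytope_convex => //.
  by case/andP: t01 alpha01 => ? ? /andP[? ?]; rewrite mulr_ge0//= mulr_ile1.
have -> : (1 - alpha) *: P i + alpha *: Y = P i + V by rewrite -[V]scale1r seg mul1r.
have gradE : block_grad f i P = mx_grad (block_fun f P (i := i)) (P i) by [].
have V2 : frobenius V ^+ 2 <= alpha ^+ 2 * (2 * d ^+ 2).
  rewrite sqr_sqrtr ?inner_self_ge0// innerZl innerZr mulrA -expr2.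
  rewrite ler_wpM2l ?sqr_ge0// -[leLHS]sqr_sqrtr ?inner_self_ge0//.
  exact: polytope_diam.
have := @descent R _ _ (block_fun f P (i := i)) (P i) V (L * frobenius V ^+ 2).
have -> : block_fun f P (P i) = f P by rewrite /block_fun dfwith_self.
rewrite -gradE innerZr => le_descent.
apply: (le_trans (le_descent _ _)).
- move=> t t01; have := f_diff i (feasible_dfwith P_ab (seg_ab t t01)).
  by rewrite /block_differentiable block_fun_dfwith dfwithin.
- move=> t t01; rewrite -block_grad_dfwith gradE -/(block_grad f i P).
  have t0 : 0 <= t by case/andP: t01.
  apply: (le_trans (inner_le_frobenius _ _)).
  have -> : L * frobenius V ^+ 2 * t = L * (t * frobenius V) * frobenius V by ring.
  rewrite ler_wpM2r ?sqrtr_ge0//.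
  apply: (le_trans (grad_lipschitz i (feasible_dfwith P_ab (seg_ab t t01)) P_ab)).
  rewrite blocks_norm_dfwith addrAC subrr add0r ler_wpM2l//.
  by rewrite /frobenius innerZl innerZr mulrA -expr2 sqrtrM ?sqr_ge0// sqrtr_sqr ger0_norm.
- rewrite lerD2l; have := ler_wpM2l L_ge0 V2; lra.
Qed.

Lemma block_residual_ge0 X i : feasible a b X -> 0 <= block_residual a b f i X.
Proof.
move=> X_ab; apply: ub_le_sup; last first.
  by exists (X i); [exact: X_ab|rewrite subrr inner0r].
(* The set must be bounded above for [sup] to dominate its members; Cauchy-Schwarz and the diameter
   provide a bound. *)
exists (frobenius (block_grad f i X) * Num.sqrt (2 * d ^+ 2)) => _ [T T_ab <-].
apply: (le_trans (inner_le_frobenius _ _)); rewrite ler_wpM2l ?sqrtr_ge0//.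
by rewrite -[leLHS]ger0_norm ?sqrtr_ge0// -sqrtr_sqr; apply: ler_wsqrtr; exact: polytope_diam.
Qed.

Lemma block_residual_le X i (c : R) : feasible a b X ->
  (forall T, transport_polytope (a i) (b i) T ->
    inner (block_grad f i X) (X i - T) <= c) -> block_residual a b f i X <= c.
Proof.
move=> X_ab le_c; apply: ge_sup => [|_ [T T_ab <-]]; last exact: le_c.
by exists (inner (block_grad f i X) (X i - X i)), (X i); first exact: X_ab.
Qed.

(** * Decrease along the iterates and summation *)

Section Iterates.
Variables (tmax : nat) (lam alpha : R) (X : nat -> blocks R s).
Hypothesis a_sum1 : forall i, \sum_j a i j ord0 = 1.
Hypothesis X0_feasible : feasible a b (X 0%N).
Hypothesis X_eralm : eralm a b f tmax (fun _ _ => lam) (fun _ _ => alpha) X.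

(** [partial_update] with a natural number index, so that [k = N] is allowed and the decreases
    telescope from [X t] to [X t.+1]. *)
Definition sweep (t k : nat) : blocks R s := fun j => if (j < k)%N then X t.+1 j else X t j.

Lemma sweep0 t : sweep t 0 = X t.
Proof. exact: blocks_ext. Qed.

Lemma sweepN t : sweep t N = X t.+1.
Proof. by apply: blocks_ext => j; rewrite /sweep ltn_ord. Qed.

Lemma sweepS t i : sweep t i.+1 = dfwith (sweep t i) i (X t.+1 i).
Proof.
apply: blocks_ext => j; have [<-|ij] := eqVneq i j; first by rewrite dfwithin /sweep ltnSn.
have ji : (j == i :> nat) = false by rewrite eq_sym; exact: negbTE ij.
by rewrite dfwithout// /sweep ltnS leq_eqVlt ji.
Qed.

Lemma eralm_feasible t : (t <= tmax)%N -> feasible a b (X t).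
Proof.
elim: t => [//|t IH] t_lt i; have [_ alpha01 [Xt [Xt_ab _] ->]] := X_eralm i t_lt.
case/andP: alpha01 => alpha0 alpha1.
by apply: transport_polytope_convex => //; [rewrite ltW|exact: (IH (ltnW t_lt))].
Qed.

Lemma sweep_feasible t k : (t < tmax)%N -> feasible a b (sweep t k).
Proof. by move=> t_lt j; rewrite /sweep; case: ifP => _; apply: eralm_feasible; rewrite // ltnW. Qed.

(** At most [N] blocks have moved, each by [alpha] times a difference of two polytope points;
    orthogonality of the blocks gives [sqrt N]. *)
Lemma sweep_dist t i : (t < tmax)%N ->
  blocks_norm (fun j => X t j - sweep t i j) <= Num.sqrt N%:R * (alpha * Num.sqrt (2 * d ^+ 2)).
Proof.
move=> t_lt; have [_ /andP[alpha0 _] _] := X_eralm i t_lt.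
have -> : Num.sqrt N%:R * (alpha * Num.sqrt (2 * d ^+ 2)) =
    Num.sqrt (N%:R * (alpha ^+ 2 * (2 * d ^+ 2))).
  by rewrite [RHS]sqrtrM// (@sqrtrM _ (alpha ^+ 2)) ?sqr_ge0// sqrtr_sqr gtr0_norm.
apply: ler_wsqrtr.
have -> : N%:R * (alpha ^+ 2 * (2 * d ^+ 2)) = \sum_(i < N) (alpha ^+ 2 * (2 * d ^+ 2)).
  by rewrite sumr_const card_ord mulr_natl.
apply: ler_sum => j _; rewrite /sweep; case: ifP => _; last first.
  by rewrite subrr inner0r mulr_ge0 ?sqr_ge0// mulr_ge0 ?sqr_ge0.
have [_ _ [Xt [Xt_ab _] ->]] := X_eralm j t_lt.
have -> : X t j - ((1 - alpha) *: X t j + alpha *: Xt) = alpha *: (X t j - Xt).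
  by rewrite scalerBr scalerBl scale1r opprD opprB addrA addrCA subrr addr0.
rewrite innerZl innerZr mulrA -expr2 ler_wpM2l ?sqr_ge0//.
rewrite -[leLHS]sqr_sqrtr ?inner_self_ge0//; apply: polytope_diam => //.
exact: (eralm_feasible (ltnW t_lt)).
Qed.

(* The three error terms: the entropic gap, the curvature of [f] along block
   [i], and the drift of the gradient between [X t] and [sweep t i]. *)
Lemma block_residual_decrease t i : (t < tmax)%N ->
  block_residual a b f i (X t) <=
    alpha^-1 * (f (sweep t i) - f (sweep t i.+1)) +
    lam * ln (nrow s i * ncol s i)%:R + L * alpha * d ^+ 2 * (2 * Num.sqrt N%:R + 1).
Proof.
move=> t_lt; have [lam0 /andP[alpha0 alpha1] [Xt Xt_sol XtE]] := X_eralm i t_lt.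
have Xt_ab := eralm_feasible (ltnW t_lt).
have sweep_ab := sweep_feasible i t_lt.
apply: (block_residual_le Xt_ab) => T T_ab.
set G := block_grad f i (X t); set C := block_grad f i (sweep t i).
(* Block [i] is still old when its turn comes, so the subproblem is centred at [X t i]. *)
have sweep_i : sweep t i i = X t i by rewrite /sweep ltnn.
have entropic : inner C (Xt - X t i) <= - inner C (X t i - T) + lam * ln (nrow s i * ncol s i)%:R.
  apply: (entropic_solution_le _ _ _ _ Xt_sol T_ab); rewrite ?ltW//.
    exact: nrow_gt0.
  exact: ncol_gt0.
have : f (sweep t i.+1) <= f (sweep t i) + alpha * inner C (Xt - X t i) + L * alpha ^+ 2 * d ^+ 2.
  rewrite sweepS XtE -sweep_i; apply: block_descent => //.
    by case: Xt_sol.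
  by rewrite ltW.
move=> le_descent.
have drift : inner G (X t i - T) - inner C (X t i - T) <=
    L * (Num.sqrt N%:R * (alpha * Num.sqrt (2 * d ^+ 2))) * Num.sqrt (2 * d ^+ 2).
  rewrite -innerBl; apply: (le_trans (inner_le_frobenius _ _)).
  apply: ler_pM; rewrite ?sqrtr_ge0//; last first.
    rewrite -[leLHS]ger0_norm ?sqrtr_ge0// -sqrtr_sqr; apply: ler_wsqrtr.
    by apply: polytope_diam => //; exact: Xt_ab.
  apply: (le_trans (grad_lipschitz i Xt_ab sweep_ab)).
  by rewrite ler_wpM2l// sweep_dist.
have {}drift : inner G (X t i - T) - inner C (X t i - T) <= 2 * L * alpha * d ^+ 2 * Num.sqrt N%:R.
  apply: (le_trans drift); rewrite le_eqVlt; apply/orP; left; apply/eqP.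
  have r2 : Num.sqrt (2 * d ^+ 2) ^+ 2 = 2 * d ^+ 2 by rewrite sqr_sqrtr// mulr_ge0 ?sqr_ge0.
  by move: r2; set r := Num.sqrt (2 * _) => r2; ring: r2.
rewrite -(ler_pM2l alpha0).
rewrite !(mulrDr alpha) mulVKf ?gt_eqF//.
have := ler_wpM2l (ltW alpha0) drift; have := ler_wpM2l (ltW alpha0) entropic.
lra.
Qed.

(** The decreases of [f] telescope twice, over the blocks of an iteration and over the iterations;
    the error terms do not depend on [t]. *)
Lemma sum_residual_le (f_low : R) : (0 < N)%N -> (0 < tmax)%N -> f_low <= f (X tmax) ->
  \sum_(0 <= t < tmax) residual a b f (X t) <=
    alpha^-1 * (f (X 0%N) - f_low) +
    tmax%:R * (lam * (\sum_(i < N) ln (nrow s i * ncol s i)%:R) +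
               L * alpha * d ^+ 2 * N%:R * (2 * Num.sqrt N%:R + 1)).
Proof.
move=> N_gt0 tmax_gt0 f_low_le.
have [_ /andP[alpha0 _] _] := X_eralm (Ordinal N_gt0) tmax_gt0.
set E := (lam * _ + _).
have iter_le t : (t < tmax)%N ->
    residual a b f (X t) <= alpha^-1 * (f (X t) - f (X t.+1)) + E.
  move=> t_lt; apply: (le_trans (ler_sum _ (fun i _ => block_residual_decrease i t_lt))).
  rewrite !big_split /= -!mulr_sumr sumr_const card_ord -addrA /E.
  have -> : \sum_(i < N) (f (sweep t i) - f (sweep t i.+1)) = f (X t) - f (X t.+1).
    rewrite -(big_mkord xpredT (fun k => f (sweep t k) - f (sweep t k.+1))).
    (* The sign is flipped because the summands are decreases rather than increments. *)
    rewrite (telescope_sumr_eq (fun k => - f (sweep t k)))//; last by move=> k _; rewrite opprK addrC.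
    by rewrite sweep0 sweepN opprK addrC.
  by rewrite -mulr_natr; lra.
apply: (@le_trans _ _ (\sum_(0 <= t < tmax) (alpha^-1 * (f (X t) - f (X t.+1)) + E))).
  by rewrite !big_mkord; apply: ler_sum => t _; exact: iter_le.
rewrite big_split /= -mulr_sumr sumr_const_nat subn0 mulr_natl lerD2r.
rewrite ler_wpM2l ?invr_ge0 ?(ltW alpha0)//.
rewrite (telescope_sumr_eq (fun t => - f (X t)))//; last by move=> t _; rewrite opprK addrC.
by move: f_low_le; lra.
Qed.

End Iterates.

End Blocks.

(** * Bounds from the ratio condition, the step size and growth rates *)

Lemma vec_norm_le (R : realType) m (a : 'cV[R]_m) (q : R) : (0 < m)%N -> 0 <= q ->
  (forall j, 0 <= a j ord0) -> \sum_j a j ord0 = 1 ->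
  vec_max a <= q * vec_min a -> `|a| <= q / m%:R.
Proof.
move=> m0 q0 a0 a1 ratio; have m0R : (0 : R) < m%:R by rewrite ltr0n.
(* The minimum is at most the mean of entries summing to 1. *)
have min_le : vec_min a <= m%:R^-1.
  rewrite -[m%:R^-1]mul1r ler_pdivlMr// mulr_natr -[leRHS]a1 -[X in _ *+ X]card_ord -sumr_const.
  apply: ler_sum => j _; apply: ge_inf; last by exists j.
  by exists 0 => _ [i _ <-].
rewrite [leLHS]mx_normrE; apply: bigmax_le => [|[j k] _ /=]; first by rewrite divr_ge0// ltW.
rewrite ord1 ger0_norm//; apply: (@le_trans _ _ (vec_max a)).
  apply: ub_le_sup; last by exists j.
  by exists 1 => _ [i _ <-]; rewrite -a1 (bigD1 i)//= lerDl sumr_ge0.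
by apply: (le_trans ratio); rewrite ler_wpM2l.
Qed.

(** The row term of each minimum is at most [sqrt m * (q / m)], and [sqrt m <= m] for [m >= 1]. *)
Lemma dbar_le (R : realType) N (s : sizes N)
    (a : forall i, 'cV[R]_(nrow s i)) (b : forall i, 'cV[R]_(ncol s i)) (q : R) : 0 <= q ->
  (forall i j, 0 <= a i j ord0) -> (forall i, \sum_j a i j ord0 = 1) ->
  (forall i, vec_max (a i) <= q * vec_min (a i)) -> dbar a b <= q.
Proof.
move=> q0 a0 a1 ratio; apply: bigmax_le => // i _; rewrite /dim_const ge_min.
have m1 : (1 : R) <= (nrow s i)%:R by rewrite ler1n nrow_gt0.
apply/orP; left; apply: (@le_trans _ _ ((nrow s i)%:R * (q / (nrow s i)%:R))); last first.
  by rewrite mulrC divfK// gt_eqF// (lt_le_trans ltr01).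
apply: ler_pM; rewrite ?sqrtr_ge0//; last by apply: vec_norm_le; rewrite ?nrow_gt0.
rewrite -[leRHS]ger0_norm// -sqrtr_sqr ler_wsqrtr// expr2 ler_peMr//.
Qed.

(* The step size balances [Delta / (T x)] against [K d^2 x]. *)
Lemma stepsize_bound (R : realType) (Delta K d T Lam : R) :
  let x := d^-1 * Num.sqrt (Delta / (2 * K * T)) in
  0 <= d -> 0 <= K -> 0 < T -> 0 < x ->
  T^-1 * (x^-1 * Delta + T * (Lam + K * x * d ^+ 2)) =
    3 * d * Num.sqrt (Delta / 2 * (K / T)) + Lam.
Proof.
move=> x d0 K0 T0 x0.
(* As [0^-1 = 0], a vanishing [d] would force [x = 0]; the same argument gives [K_gt0] below. *)
have d_gt0 : 0 < d.
  by rewrite lt_def d0 andbT; apply: contraTneq x0 => d_eq0; rewrite /x d_eq0 invr0 mul0r ltxx.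
set r := Num.sqrt (Delta / (2 * K * T)).
have r0 : 0 < r by move: x0; rewrite /x pmulr_rgt0 ?invr_gt0.
have r2 : r ^+ 2 = Delta / (2 * K * T).
  by rewrite sqr_sqrtr// ltW// -sqrtr_gt0.
have K_gt0 : 0 < K.
  rewrite lt_def K0 andbT; apply: contraTneq r0 => K_eq0.
  by rewrite /r K_eq0 mulr0 mul0r invr0 mulr0 sqrtr0 ltxx.
have DeltaE : Delta = 2 * K * T * r ^+ 2 by rewrite r2; field; rewrite !gt_eqF.
have -> : Num.sqrt (Delta / 2 * (K / T)) = K * r.
  rewrite -[RHS]ger0_norm ?mulr_ge0 1?ltW// -sqrtr_sqr; congr Num.sqrt.
  by rewrite DeltaE; field; rewrite gt_eqF.
rewrite /x -/r [in x in x = _]DeltaE.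
by field; rewrite (gt_eqF T0) (gt_eqF r0) (gt_eqF d_gt0).
Qed.

(** Let [S i] be the largest [nrow + ncol]. The left sum is at most [N * S i ^ theta], the right one
    at least [S i ^ eta], and [S i] tends to infinity since it is at least the average. *)
Lemma sum_powR_littleo (R : realType) N (theta eta e : R) :
  (0 < N)%N -> 0 <= theta -> theta < eta -> 0 < e ->
  \forall s \near sizes_oo N,
    \sum_(i < N) (nrow s i + ncol s i)%:R `^ theta <=
      e * \sum_(i < N) (nrow s i + ncol s i)%:R `^ eta :> R.
Proof.
move=> N_gt0 theta0 theta_eta e0.
have te : 0 < eta - theta by rewrite subr_gt0.
(* Solves [e * B ^ (eta - theta) = N]. *)
pose B : R := (N%:R / e) `^ (eta - theta)^-1.
exists (N * (Num.truncn B).+1)%N => // s /= s_large.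
case: (@arg_maxnP _ (Ordinal N_gt0) xpredT (fun i => (nrow s i + ncol s i)%N)) => // i _ i_max.
set S := fun i => (nrow s i + ncol s i)%N in s_large i_max *.
have S_large : B <= (S i)%:R.
  apply: (@le_trans _ _ (Num.truncn B).+1%:R); first by rewrite ltW// truncnS_gt.
  rewrite ler_nat -(leq_pmul2l N_gt0); apply: (leq_trans s_large).
  rewrite -[X in (_ <= X * _)%N]card_ord -sum_nat_const.
  by apply: leq_sum => j _; exact: i_max.
have Si0 : (0 : R) < (S i)%:R by rewrite ltr0n addn_gt0 nrow_gt0.
have Ne0 : 0 < N%:R / e :> R by rewrite divr_gt0 ?ltr0n.
apply: (@le_trans _ _ (N%:R * (S i)%:R `^ theta)).
  rewrite mulr_natl -[X in _ *+ X]card_ord -sumr_const; apply: ler_sum => j _.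
  by apply: ge0_ler_powR; rewrite ?nnegrE ?ler0n// ler_nat; exact: i_max.
apply: (@le_trans _ _ (e * (S i)%:R `^ eta)); last first.
  by rewrite ler_wpM2l ?(ltW e0)// (bigD1 i)//= lerDl sumr_ge0// => j _; exact: powR_ge0.
rewrite -[eta](subrK theta) powRD; last by rewrite (gt_eqF Si0) implybT.
rewrite mulrA ler_wpM2r ?powR_ge0// -ler_pdivrMl// mulrC.
apply: (@le_trans _ _ (B `^ (eta - theta))).
  by rewrite /B -powRrM mulVf ?gt_eqF// powRr1// ltW.
by apply: ge0_ler_powR; rewrite ?nnegrE ?(ltW te) ?powR_ge0.
Qed.

(** * Passage to the limit *)

Theorem corollary1 (R : realType) (N : nat) (N_gt0 : (0 < N)%N)
  (a : forall (s : sizes N) (i : 'I_N), 'cV[R]_(nrow s i))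
  (b : forall (s : sizes N) (i : 'I_N), 'cV[R]_(ncol s i))
  (f : forall s : sizes N, blocks R s -> R)
  (L lambda : sizes N -> R) (tmax : sizes N -> nat)
  (X : forall s : sizes N, nat -> blocks R s)
  (f_low q theta eta M : R)
  (a_ge0 : forall s i j, 0 <= a s i j ord0)
  (b_ge0 : forall s i k, 0 <= b s i k ord0)
  (f_diff : forall s (Y : blocks R s) i,
     feasible (a s) (b s) Y -> block_differentiable (f s) Y i)
  (* (a) *)
  (L_ge0 : forall s, 0 <= L s)
  (grad_lipschitz : forall s i (Y Y' : blocks R s),
     feasible (a s) (b s) Y -> feasible (a s) (b s) Y' ->
     frobenius (block_grad (f s) i Y - block_grad (f s) i Y')
       <= L s * blocks_norm (fun j => Y j - Y' j))
  (* (b) *)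
  (f_bounded : forall s, (f_low%:E <= optimal_value (a s) (b s) (f s))%E)
  (* (c) *)
  (q_gt0 : 0 < q)
  (a_sum1 : forall s i, \sum_j a s i j ord0 = 1)
  (b_sum1 : forall s i, \sum_k b s i k ord0 = 1)
  (a_ratio : forall s i, vec_max (a s i) <= q * vec_min (a s i))
  (b_ratio : forall s i, vec_max (b s i) <= q * vec_min (b s i))
  (* (d) *)
  (theta_ge0 : 0 <= theta)
  (L_bigO : L =O_ (sizes_oo N)
     (fun s => \sum_(i < N) (nrow s i + ncol s i)%:R `^ theta))
  (* the method and its parameters *)
  (eta_gt_theta : theta < eta)
  (tmax_Omega : ((fun s => (tmax s)%:R) : sizes N -> R) \is 'Omega_(sizes_oo N)
     (fun s => \sum_(i < N) (nrow s i + ncol s i)%:R `^ eta))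
  (tmax_ge : forall s,
     (f s (X s 0%N) - f_low) /
       (2 * dbar (a s) (b s) ^+ 2 * L s * N%:R * (2 * Num.sqrt N%:R + 1))
     <= (tmax s)%:R)
  (X0_feasible : forall s, feasible (a s) (b s) (X s 0%N))
  (f_X0_le : forall s, f s (X s 0%N) <= M)
  (lambda_littleo : lambda =o_ (sizes_oo N)
     (fun s => (\sum_(i < N) ln (nrow s i * ncol s i)%:R)^-1))
  (X_eralm : forall s,
     let alpha :=
       (dbar (a s) (b s))^-1 *
       Num.sqrt ((f s (X s 0%N) - f_low) /
         (2 * L s * N%:R * (2 * Num.sqrt N%:R + 1) * (tmax s)%:R)) in
     eralm (a s) (b s) (f s) (tmax s)
       (fun _ _ => lambda s) (fun _ _ => alpha) (X s)) :
  (fun s => (tmax s)%:R^-1 *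
     \sum_(0 <= t < tmax s) residual (a s) (b s) (f s) (X s t)) s
    @[s --> sizes_oo N] --> (0 : R).
Proof.
have q0 := ltW q_gt0; have theta_le_eta := ltW eta_gt_theta.
pose K s := L s * N%:R * (2 * Num.sqrt N%:R + 1).
pose Lam s := lambda s * \sum_(i < N) ln (nrow s i * ncol s i)%:R.
(* What remains of [Delta * K / 2] once [Delta] is bounded by [M - f_low] and [L] is split off; it
   is independent of the sizes. *)
pose c := (M - f_low) / 2 * (N%:R * (2 * Num.sqrt N%:R + 1)).
have NN0 : 0 <= N%:R * (2 * Num.sqrt N%:R + 1) :> R.
  by rewrite mulr_ge0// addr_ge0// mulr_ge0// sqrtr_ge0.
(* Positivity of the comparison sums removes the norms in the asymptotic hypotheses and makes [tmax]
   eventually positive. *)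
have Sum_ge1 s r : 0 <= r -> 1 <= \sum_(i < N) (nrow s i + ncol s i)%:R `^ r :> R.
  move=> r0; rewrite (bigD1 (Ordinal N_gt0))//= -[leLHS]addr0.
  apply: lerD; last by apply: sumr_ge0 => i _; exact: powR_ge0.
  have n1 : 1 <= (nrow s (Ordinal N_gt0) + ncol s (Ordinal N_gt0))%:R :> R.
    by rewrite ler1n addn_gt0 nrow_gt0.
  by rewrite -[leLHS](powRr0 (nrow s (Ordinal N_gt0) + ncol s (Ordinal N_gt0))%:R) ler_powR.
have [k k0 T_ge] : exists2 k : R, 0 < k & \forall s \near sizes_oo N,
    k * \sum_(i < N) (nrow s i + ncol s i)%:R `^ eta <= (tmax s)%:R.
  have /asboolP[k k0 T_ge] := tmax_Omega.
  exists k => //; apply: filterS T_ge => s.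
  by rewrite !ger0_norm// (le_trans ler01)// Sum_ge1// (le_trans theta_ge0).
have [l l0 L_le] : exists2 l : R, 0 < l & \forall s \near sizes_oo N,
    L s <= l * \sum_(i < N) (nrow s i + ncol s i)%:R `^ theta.
  have /eqO_exP[l l0 L_le] := L_bigO.
  exists l => //; apply: filterS L_le => s.
  by rewrite !ger0_norm// (le_trans ler01)// Sum_ge1.
have LT_cvg : (fun s => L s / (tmax s)%:R) s @[s --> sizes_oo N] --> (0 : R).
  apply/cvgr0Pnorm_le => e e0.
  (* With this tolerance, [L <= l * (e * k / l) * Sum_eta = e * (k * Sum_eta) <= e * tmax], where
     [Sum_eta] is the sum of the powers [eta]. *)
  have e'0 : 0 < e * k / l by rewrite divr_gt0// mulr_gt0.
  have := sum_powR_littleo N_gt0 theta_ge0 eta_gt_theta e'0.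
  apply: filterS3 T_ge L_le => s T_ge L_le sum_le.
  have eta0 : 0 < \sum_(i < N) (nrow s i + ncol s i)%:R `^ eta :> R.
    by rewrite (lt_le_trans ltr01)// Sum_ge1// (le_trans theta_ge0).
  have T0 : 0 < (tmax s)%:R :> R by apply: lt_le_trans T_ge; rewrite mulr_gt0.
  rewrite ger0_norm ?divr_ge0// ler_pdivrMr//.
  apply: (le_trans L_le); apply: (le_trans (ler_wpM2l (ltW l0) sum_le)).
  rewrite mulrA (mulrC l) divfK ?gt_eqF// -mulrA.
  by rewrite ler_wpM2l// ltW.
have Lam_cvg : Lam s @[s --> sizes_oo N] --> (0 : R).
  apply/cvgr0Pnorm_le => e e0.
  have /eqoP/(_ e e0) := lambda_littleo; apply: filterS => s; rewrite /Lam normrM.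
  (* If all blocks are 1 by 1 then [S = 0] and cannot be divided by, but [Lam] is then 0 anyway. *)
  set S := \sum_(i < N) _; have [->|S0] := eqVneq S 0.
    by rewrite normr0 mulr0 => _; exact: ltW.
  by rewrite normfV ler_pdivlMr// normr_gt0.
have bound_cvg : (fun s => 3 * q * Num.sqrt (c * (L s / (tmax s)%:R)) + Lam s) s
    @[s --> sizes_oo N] --> (0 : R).
  rewrite -[0]addr0; apply: cvgD Lam_cvg.
  rewrite -(mulr0 (3 * q)); apply: cvgMr.
  rewrite -[in X in _ --> X]sqrtr0 -(mulr0 c).
  apply: continuous_cvg; first exact: sqrt_continuous.
  exact: cvgMr.
apply: (squeeze_cvgr _ (cvg_cst 0) bound_cvg).
apply: filterS T_ge => s T_ge.
have T0 : 0 < (tmax s)%:R :> R.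
  apply: lt_le_trans T_ge; rewrite mulr_gt0// (lt_le_trans ltr01)// Sum_ge1//.
  exact: le_trans theta_le_eta.
have T_gt0 : (0 < tmax s)%N by rewrite -(ltr0n R).
have dbar0 : 0 <= dbar (a s) (b s).
  exact: le_trans (dim_const_ge0 _ _ _) (dim_const_le_dbar _ _ (Ordinal N_gt0)).
have dbar_q : dbar (a s) (b s) <= q by apply: dbar_le.
have dim_le := dim_const_le_dbar (a s) (b s).
have eralm_s := X_eralm s; cbv zeta in eralm_s.
have X_feas := eralm_feasible (X0_feasible s) eralm_s.
have f_low_le t : (t <= tmax s)%N -> f_low <= f s (X s t).
  move=> t_le; rewrite -lee_fin; apply: (le_trans (f_bounded s)).
  by apply: ereal_inf_lbound; exists (X s t) => //; exact: X_feas.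
(* The method itself requires a positive step size, which [stepsize_bound] takes as a hypothesis. *)
have [lam0 /andP[alpha0 _] _] := eralm_s 0%N (Ordinal N_gt0) T_gt0.
have K0 : 0 <= K s by rewrite /K -mulrA mulr_ge0.
apply/andP; split.
  rewrite mulr_ge0 ?invr_ge0 ?ler0n// big_mkord sumr_ge0// => t _.
  apply: sumr_ge0 => i _; apply: (block_residual_ge0 _ dim_le).
  by apply: X_feas; exact: ltnW.
have := sum_residual_le (L_ge0 s) (@f_diff s) (@grad_lipschitz s) dim_le
  (a_sum1 s) (X0_feasible s) eralm_s N_gt0 T_gt0 (f_low_le _ (leqnn _)).
have KE : 2 * L s * N%:R * (2 * Num.sqrt N%:R + 1) * (tmax s)%:R = 2 * K s * (tmax s)%:R.
  by rewrite /K !mulrA.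
rewrite KE in alpha0 *; set x := _^-1 * _ in alpha0 *.
have -> : L s * x * dbar (a s) (b s) ^+ 2 * N%:R * (2 * Num.sqrt N%:R + 1) =
    K s * x * dbar (a s) (b s) ^+ 2 by rewrite /K; ring.
rewrite -/(Lam s) => sum_le.
have Ti : 0 <= (tmax s)%:R^-1 :> R by rewrite invr_ge0.
apply: (le_trans (ler_wpM2l Ti sum_le)).
(* It remains to replace [dbar] by [q] and [f (X 0) - f_low] by [M - f_low]. *)
rewrite stepsize_bound// lerD2r; apply: ler_pM => //; rewrite ?sqrtr_ge0 ?mulr_ge0//.
  by rewrite ler_wpM2l.
apply: ler_wsqrtr.
have -> : c * (L s / (tmax s)%:R) = (M - f_low) / 2 * (K s / (tmax s)%:R).
  by rewrite /c /K; ring.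
by rewrite ler_wpM2r ?mulr_ge0// ler_wpM2r ?invr_ge0// lerD2r.
Qed.
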